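(* For any covering instance of the general MIP (with its tree-structured reformulation), let $\tau=\max_{v\in V(\mathcal{G})}|\{i\in V(\mathcal{T}):v\in\mathcal{Q}_i\}|$. Then for $k\in[n]$, $$\frac{\theta_k}{1-\tau+\tau\cdot\theta_k}\cdot\mathrm{OPT}\ \le\ \mathrm{DUAL}^M_k\ \le\ \mathrm{OPT}.$$
   Context: $\mathbf{conv}$ denotes convex hull; $\min$ is read as infimum in the extended reals. General MIP: $\min\{c^\top x: Ax\le b,\ x \text{ mixed-binary}\}$ with $n$ variables and rational $c,b,A$, where a prescribed subset of the variables is required to be in $\{0,1\}$ and the others are continuous and non-negative. Its intersection graph $\mathcal{G}$ has one vertex per variable, two vertices being adjacent iff the variables appear in a common constraint of $Ax\le b$. A tree decomposition of $\mathcal{G}$ is a pair $(\mathcal{T},\mathcal{Q})$ with $\mathcal{T}$ a tree and $\mathcal{Q}=\{\mathcal{Q}_t\subseteq V(\mathcal{G}):t\in V(\mathcal{T})\}$ such that: for each $v\in V(\mathcal{G})$ the set $\{t:v\in\mathcal{Q}_t\}$ forms a subtree of $\mathcal{T}$; each edge $(u,v)$ of $\mathcal{G}$ has $u,v\in\mathcal{Q}_t$ for some $t$; and $\bigcup_t\mathcal{Q}_t=V(\mathcal{G})$. Put $\mathcal{Q}_{ij}=\mathcal{Q}_i\cap\mathcal{Q}_j$. Tree-structured reformulation: each block $i\in V(\mathcal{T})$ has local copies $x^{(i)}=(x^{(i)}_v)_{v\in\mathcal{Q}_i}$ of the variables in $\mathcal{Q}_i$ (with the same binary/non-negativity restrictions);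 each constraint of $Ax\le b$ is assigned to some block whose bag contains all its variables, and $\mathcal{X}^{(i)}$ is the set of $x^{(i)}$ satisfying the constraints assigned to block $i$ and these restrictions. The objective is split as $\sum_i\langle c^{(i)},x^{(i)}\rangle$ with $\sum_{i:v\in\mathcal{Q}_i}c^{(i)}_v=c_v$. The problem is $$\mathrm{OPT}=\min\Big\{\sum_{i\in V(\mathcal{T})}\langle c^{(i)},x^{(i)}\rangle:\ x^{(i)}\in\mathcal{X}^{(i)}\ \forall i\in V(\mathcal{T}),\ x^{(i)}_v=x^{(j)}_v\ \forall (i,j)\in E(\mathcal{T}),\,v\in\mathcal{Q}_{ij}\Big\}.$$ Standing assumption: every $v\in\mathcal{Q}_{ij}$, $(i,j)\in E(\mathcal{T})$, is a binary variable. The instance is covering if all $c^{(i)}$ are entrywise non-negative and $A,b$ are entrywise non-positive. M-Lagrangian dual of level $k$: let $\mathcal{X}^{(i)}_M=\{(x^{(i)},w^{(i)}):x^{(i)}\in\mathcal{X}^{(i)},\ w^{(i)}_S=\prod_{v\in S}x^{(i)}_v\ \forall S\subseteq\mathcal{Q}_i\}$, and let $\mathcal{S}_{ij}=\binom{\mathcal{Q}_{ij}}{\le k}$ be the collection of subsets of $\mathcal{Q}_{ij}$ of cardinality at most $k$. The value of the dual obtained by dualizing $w^{(i)}_S=w^{(j)}_S$, $(i,j)\in E(\mathcal{T})$, $S\in\mathcal{S}_{ij}$, is given by its primal characterization $$\mathrm{DUAL}^M_k=\min\Big\{\sum_{i}\langle c^{(i)},x^{(i)}\rangle:\ (x^{(i)},w^{(i)})\in\mathbf{conv}\{\mathcal{X}^{(i)}_M\}\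 \forall i\in V(\mathcal{T}),\ w^{(i)}_S=w^{(j)}_S\ \forall (i,j)\in E(\mathcal{T}),\,S\in\mathcal{S}_{ij}\Big\}.$$ $k$-good sets: for a subset $\mathcal{W}$ of the variables, let $\mathcal{T}(\mathcal{W})$ be the subgraph of $\mathcal{T}$ induced by $\{i\in V(\mathcal{T}):\mathcal{Q}_i\cap\mathcal{W}\ne\emptyset\}$. $\mathcal{W}$ is $k$-good if every connected component $\mathcal{C}$ of $\mathcal{T}(\mathcal{W})$ satisfies $|\mathcal{Q}_i\cap\mathcal{Q}_j\cap\mathcal{W}|\le k$ for every $(i,j)\in E(\mathcal{C})$. With $\chi_{\mathcal{W}}$ the $0/1$ indicator vector of $\mathcal{W}$ and $\mathbf{1}$ the all-ones vector, $$\theta_k=\min\Big\{\sum_{\mathcal{W}\ k\text{-good}}\alpha_{\mathcal{W}}:\ \sum_{\mathcal{W}\ k\text{-good}}\alpha_{\mathcal{W}}\chi_{\mathcal{W}}\ge\mathbf{1},\ \alpha\ge 0\Big\}.$$ *)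

(* Defs.v *)
From HB Require Import structures.
From mathcomp Require Import all_boot all_order all_algebra.
From mathcomp Require Import boolp classical_sets reals constructive_ereal ereal.

Set Implicit Arguments.
Unset Strict Implicit.
Unset Printing Implicit Defensive.

Import Order.TTheory GRing.Theory Num.Theory.

Local Open Scope classical_set_scope.
Local Open Scope ring_scope.

Section Graphs.
Variables (V : finType) (e : rel V).

Definition induced (S : {set V}) : rel V :=
  [rel i j | [&& i \in S, j \in S & e i j]].

(* Nonempty, connected, and without a simple cycle (a cycle has at least
   three vertices). *)
Definition tree_on (S : {set V}) : Prop :=
  [/\ exists i, i \in S,
      {in S &, forall i j, connect (induced S) i j} &
      forall p : seq V, (2 < size p)%N -> ~~ ucycleb (induced S) p].

Definition is_tree : Prop :=
  [/\ symmetric e, irreflexive e & tree_on [set: V]%SET].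

Definition components (S : {set V}) : {set {set V}} :=
  equivalence_partition (connect (induced S)) S.

End Graphs.

Record tree_decomposition (U : finType) (g : rel U)
    (V : finType) (e : rel V) (bag : V -> {set U}) : Prop := TreeDecomposition {
  td_tree : is_tree e;
  td_subtree : forall u : U, tree_on e [set i | u \in bag i]%SET;
  td_edge : forall u v : U, g u v -> exists i, (u \in bag i) && (v \in bag i);
  td_cover : forall u : U, exists i, u \in bag i
}.

(* min cost *m x subject to A *m x <= rhs, where the variables in [binary] range
   over {0, 1} and the other ones are continuous and non-negative. *)
Record mip (n m : nat) := Mip {
  cost : 'rV[rat]_n;
  lhs : 'M[rat]_(m, n);
  rhs : 'cV[rat]_m;
  binary : {set 'I_n}
}.

Definition appears n m (P : mip n m) (r : 'I_m) (v : 'I_n) : bool :=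
  lhs P r v != 0.

Definition intersection_graph n m (P : mip n m) : rel 'I_n :=
  [rel u v | (u != v) && [exists r, appears P r u && appears P r v]].

Record reformulation (R : realType) n m (P : mip n m) := Reformulation {
  node : finType;
  adj : rel node;
  bag : node -> {set 'I_n};
  bag_decomposition : tree_decomposition (intersection_graph P) adj bag;
  block_of : 'I_m -> node;
  block_of_bag : forall r v, appears P r v -> v \in bag (block_of r);
  (* [bcost i] is only relevant at the variables of [bag i]. *)
  bcost : node -> 'I_n -> R;
  bcost_split : forall v,
    \sum_(i | v \in bag i) bcost i v = ratr (cost P 0 v)
}.

Arguments adj {R n m P} _.
Arguments bag {R n m P} _.
Arguments block_of {R n m P} _.
Arguments bcost {R n m P} _.

(* Finite convex combinations of points of A. *)
Definition conv (R : realType) (E : lmodType R) (A : set E) : set E :=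
  [set z | exists (N : nat) (l : 'I_N -> R) (p : 'I_N -> E),
    [/\ forall s, 0 <= l s, \sum_s l s = 1, forall s, A (p s) &
        z = \sum_s l s *: p s]].

Section Reformulation.
Variables (R : realType) (n m : nat) (P : mip n m) (T : reformulation R P).

Let V := node T.

(* The vector x^(i), indexed by [bag T i], is represented by a vector indexed by
   all the variables whose entries outside [bag T i] are unconstrained and never
   used; likewise w^(i) is indexed by all sets of variables, and only its entries
   at the subsets of [bag T i] matter. *)
Definition xspace := 'cV[R]_n.
Definition wspace := {ffun {set 'I_n} -> R^o}.

Definition blockX (i : V) : set xspace :=
  [set x | (forall r, block_of T r = i ->
              \sum_(v in bag T i) ratr (lhs P r v) * x v 0 <= ratr (rhs P r 0)) /\
           (forall v, v \in bag T i ->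
              if v \in binary P then x v 0 = 0 \/ x v 0 = 1 else 0 <= x v 0)].

Definition blockXM (i : V) : set (xspace * wspace)%type :=
  [set y : (xspace * wspace)%type | blockX i y.1 /\
           (forall S : {set 'I_n}, S \subset bag T i ->
              y.2 S = \prod_(v in S) y.1 v 0)].

Definition objective (x : V -> xspace) : R :=
  \sum_(i : V) \sum_(v in bag T i) bcost T i v * x i v 0.

Definition OPT : \bar R :=
  ereal_inf [set (objective x)%:E | x in
    [set x : V -> xspace |
      (forall i, blockX i (x i)) /\
      (forall i j v, adj T i j -> v \in bag T i :&: bag T j ->
         x i v 0 = x j v 0)]].

Definition DUAL_M (k : nat) : \bar R :=
  ereal_inf [set (objective (fun i => (y i).1))%:E | y in
    [set y : V -> (xspace * wspace)%type |
      (forall i, conv (blockXM i) (y i)) /\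
      (forall i j (S : {set 'I_n}), adj T i j ->
         S \subset bag T i :&: bag T j -> (#|S| <= k)%N ->
         (y i).2 S = (y j).2 S)]].

Definition shared_binary : Prop :=
  forall i j v, adj T i j -> v \in bag T i :&: bag T j ->
    v \in binary P.

Definition covering : Prop :=
  [/\ forall (i : V) v, v \in bag T i -> 0 <= bcost T i v,
      forall r v, lhs P r v <= 0 & forall r, rhs P r 0 <= 0].

Definition meeting (W : {set 'I_n}) : {set V} :=
  [set i | bag T i :&: W != finset.set0]%SET.

Definition k_good (k : nat) (W : {set 'I_n}) : bool :=
  [forall C in components (adj T) (meeting W),
    [forall i in C, [forall j in C,
      adj T i j ==> (#|bag T i :&: bag T j :&: W| <= k)%N]]].

Definition theta (k : nat) : \bar R :=
  ereal_inf [set (\sum_(W | k_good k W) alpha W)%:E | alpha in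
    [set alpha : {set 'I_n} -> R |
      (forall W, k_good k W -> 0 <= alpha W) /\
      (forall v, 1 <= \sum_(W | k_good k W) alpha W * (v \in W)%:R)]].

Definition tau : nat := \max_(v < n) #|[set i : V | v \in bag T i]%SET|.

End Reformulation.

(* Main.v *)
(* A dual-feasible point is a family of distributions on the blocks whose moments
   of order at most k agree along the edges of the tree. The shared variables are
   binary, so for a k-good W these moments determine the joint law of the
   variables of W shared by two adjacent blocks, and the block distributions can
   be glued along the tree into one that is consistent on W. Giving every variable
   the maximum of its copies keeps a covering instance feasible; in expectation
   this costs nothing for the variables of W and at most a factor tau for the other
   ones. Hence, with D the dual objective and D_v the part of it due to v,
   OPT <= tau D - (tau - 1) sum_(v in W) D_v for every k-good W, and averaging over
   a fractional cover by k-good sets of total weight s gives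
   s OPT <= (1 - tau + tau s) D. *)
Require Import Defs.
From mathcomp Require Import all_boot all_order all_algebra.
From mathcomp Require Import boolp classical_sets reals constructive_ereal ereal.
From mathcomp Require Import ring lra.

Set Implicit Arguments.
Unset Strict Implicit.
Unset Printing Implicit Defensive.

Import Order.TTheory GRing.Theory Num.Theory.

Local Open Scope ring_scope.

(** * Leaves of forests *)

(* The first vertex of a longest simple path: a second neighbour would either
   extend the path or close a cycle. *)
Lemma forest_leaf (V : finType) (e : rel V) (S : {set V}) :
  symmetric e -> irreflexive e ->
  (forall p : seq V, (2 < size p)%N -> ~~ ucycleb (induced e S) p) ->
  S != finset.set0 ->
  exists2 x, x \in S & {in S &, forall y z, e x y -> e x z -> y = z}.
Proof.
move=> esym eirr acyc /set0Pn[x0 x0S].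
pose P k := `[< exists x q, [/\ x \in S, path (induced e S) x q,
                               uniq (x :: q) & size q = k] >].
have exP : exists k, P k by exists 0%N; apply/asboolP; exists x0, [::].
have ubP k : P k -> (k <= #|V|)%N.
  move=> /asboolP[x [q [_ _ /card_uniqP Uq <-]]].
  by rewrite (leq_trans (leqnSn _)) // -[(size q).+1]/(size (x :: q)) -Uq max_card.
case: (ex_maxnP exP ubP) => k /asboolP[x [q [xS pq Uq sq]]] maxk.
exists x => // y z yS zS exy exz; apply/eqP/negPn/negP => neq_yz.
have extend w : w \in S -> e x w -> w \notin x :: q -> False.
  move=> wS exw wNq.
  have /maxk : P k.+1.
    apply/asboolP; exists w, (x :: q); split => //=; last by rewrite sq.
      by rewrite pq andbT /induced /= wS xS esym exw.
    by rewrite wNq -[_ && _]/(uniq (x :: q)) Uq.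
  by rewrite ltnn.
(* One of two distinct neighbours differs from the second vertex of the path; this makes the cycle
   closed below have at least three vertices. *)
have [w [wS exw headN]] : exists w, [/\ w \in S, e x w & ohead q != Some w].
  have [hy|nq] := eqVneq (ohead q) (Some y); last by exists y.
  by exists z; split; rewrite // hy; apply: contraNneq neq_yz => -[->].
have [|wNq] := boolP (w \in x :: q); last exact: extend wNq.
rewrite inE => /predU1P[wx|]; first by rewrite wx eirr in exw.
move=> wq; case/splitPr: q / wq {sq extend} pq Uq headN => -[|a q1] q2 pq Uq.
  by rewrite eqxx.
move=> _.
have /negP[] : ~~ ucycleb (induced e S) (x :: rcons (a :: q1) w).
  by apply: acyc; rewrite /= size_rcons.
rewrite /ucycleb; apply/andP; split; last first.
  by move: Uq; rewrite -cat_rcons -cat_cons cat_uniq => /andP[].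
move: pq; rewrite -cat_rcons cat_path => /andP[pq _].
rewrite -[cycle _ _]/(path _ x (rcons (rcons (a :: q1) w) x)) rcons_path pq.
by rewrite last_rcons /induced /= wS xS esym exw.
Qed.

(** * Averaging and couplings of finite distributions *)

(** If [f] exceeded its mean wherever the weight is positive, the weighted deviations would be
    non-negative with sum zero, leaving no mass. The weights are not normalized, so that this
    applies to a column of a coupling. *)
Lemma exists_le_mean (R : realFieldType) (A : finType) (p f : A -> R) :
  (forall s, 0 <= p s) -> 0 < \sum_s p s ->
  exists s, 0 < p s /\ f s * (\sum_s p s) <= \sum_s p s * f s.
Proof.
move=> p0 sp; apply/not_existsP => nex.
set m := \sum_s p s in sp nex; set M := \sum_s p s * f s in nex.
have gt s : 0 < p s -> 0 < f s * m - M.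
  by move=> ps; rewrite subr_gt0 ltNge; apply/negP => le; apply: (nex s).
have ge0 s : 0 <= p s * (f s * m - M).
  have [/gt/ltW|ps] := ltP 0 (p s); first exact: mulr_ge0.
  by rewrite (@le_anti _ _ (p s) 0) ?mul0r// ps p0.
have sum0 : \sum_s p s * (f s * m - M) = 0.
  under eq_bigr do rewrite mulrBr mulrA.
  by rewrite sumrB -!mulr_suml -/m -/M mulrC subrr.
have z s : p s = 0.
  have /eqP : p s * (f s * m - M) = 0 by apply: (psumr_eq0P _ sum0).
  rewrite mulf_eq0 => /predU1P[//|].
  have [/gt/gt_eqF->//|ps _] := ltP 0 (p s).
  by apply/le_anti; rewrite ps p0.
by move: sp; rewrite /m big1 ?ltxx.
Qed.

Definition coupling (R : numDomainType) (A B : finType) (p : A -> R) (q : B -> R)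
    (r : A -> B -> Prop) (w : A -> B -> R) : Prop :=
  [/\ forall s t, 0 <= w s t, forall s, \sum_t w s t = p s,
      forall t, \sum_s w s t = q t & forall s t, 0 < w s t -> r s t].

(** Given the common label, the two states are drawn independently. A label of mass zero causes a
    division by zero, with value 0, which is the right value since all weights with that label
    vanish. *)
Lemma coupling_pushforward (R : realFieldType) (A B : finType) (K : eqType)
    (a : A -> K) (b : B -> K) (p : A -> R) (q : B -> R) :
  (forall s, 0 <= p s) -> (forall t, 0 <= q t) ->
  (forall c, \sum_(s | a s == c) p s = \sum_(t | b t == c) q t) ->
  exists w, coupling p q (fun s t => a s = b t) w.
Proof.
move=> p0 q0 eq_pq; pose m c := \sum_(s | a s == c) p s.
exists (fun s t => if a s == b t then p s * q t / m (a s) else 0).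
split=> [s t|s|t|s t].
- by case: ifP => // _; rewrite !mulr_ge0 ?invr_ge0 ?sumr_ge0.
- rewrite -big_mkcond /=; under eq_bigl do rewrite eq_sym.
  rewrite -mulr_suml -mulr_sumr -eq_pq -/(m _).
  have [m0|m0] := eqVneq (m (a s)) 0; last by rewrite mulfK.
  by rewrite m0 mulr0 mul0r (psumr_eq0P _ m0).
- rewrite -big_mkcond /=; under eq_bigr => s /eqP-> do rewrite mulrAC.
  rewrite -!mulr_suml -/(m _).
  have [m0|m0] := eqVneq (m (b t)) 0; last by rewrite divff ?mul1r.
  by rewrite m0 !mul0r; move: m0; rewrite /m eq_pq => m0; rewrite (psumr_eq0P _ m0).
- by case: eqP; rewrite ?ltxx.
Qed.

(** * Gluing of local distributions along a forest *)

Section Gluing.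
Variables (R : realFieldType) (V : finType) (e : rel V) (A : V -> finType).
Variables (p : forall i, A i -> R) (r : forall i j, A i -> A j -> Prop).
Hypotheses (esym : symmetric e) (eirr : irreflexive e).
Hypothesis p_ge0 : forall i (s : A i), 0 <= p s.
Hypothesis p_sum : forall i, \sum_(s : A i) p s = 1.
Hypothesis rsym : forall i j (s : A i) (t : A j), r s t -> r t s.
Hypothesis rcoupling : forall i j, e i j -> exists w, coupling (@p i) (@p j) (@r i j) w.

(* A leaf [x] attached to [y] is removed by charging to each state of [y] the
   conditional expectation of the cost of [x]. *)
Lemma glue_forest (S : {set V}) (f : forall i, A i -> R) :
  (forall c : seq V, (2 < size c)%N -> ~~ ucycleb (induced e S) c) ->
  exists om : forall i, A i,
    [/\ {in S, forall i, 0 < p (om i)},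
        {in S &, forall i j, e i j -> r (om i) (om j)} &
        \sum_(i in S) f i (om i) <= \sum_(i in S) \sum_s p s * f i s].
Proof.
have [N] := ubnP #|S|; elim: N => // N IHN in S f *; rewrite ltnS => leSN acyc.
have [->|S0] := eqVneq S finset.set0.
  (* The family [om] ranges over all vertices, even those outside [S]; total mass 1 makes each [A i]
     inhabited. *)
  have inh i : exists s : A i, True.
    have [|s _] := @exists_le_mean _ _ (@p i) (@p i) (@p_ge0 i); last by exists s.
    by rewrite p_sum.
  by exists (fun i => projT1 (cid (inh i))); split=> [i|i j|]; rewrite ?inE// !big_set0.
have [x xS leaf] := forest_leaf esym eirr acyc S0.
set S' := (S :\ x)%SET.
have acyc' c : (2 < size c)%N -> ~~ ucycleb (induced e S') c.
  move=> /acyc; apply: contraNN => /andP[cc Uc]; rewrite /ucycleb Uc andbT.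
  by apply: sub_cycle cc => i j /and3P[/setD1P[_ iS] /setD1P[_ jS] eij]; apply/and3P.
have ltS'N : (#|S'| < N)%N by rewrite (leq_trans _ leSN) // [leqRHS](cardsD1 x) xS.
have sumD1 (F : V -> R) : \sum_(i in S) F i = F x + \sum_(i in S') F i.
  by rewrite (bigD1 x xS); congr (_ + _); apply: eq_bigl => i; rewrite !inE andbC.
have insert (om : forall i, A i) (s : A x) :
    {in S', forall i, 0 < p (om i)} -> 0 < p s ->
    {in S' &, forall i j, e i j -> r (om i) (om j)} ->
    {in S', forall j, e x j -> r s (om j)} ->
    f x s + \sum_(i in S') f i (om i) <= \sum_(i in S) \sum_s p s * f i s ->
  exists om : forall i, A i,
    [/\ {in S, forall i, 0 < p (om i)},
        {in S &, forall i j, e i j -> r (om i) (om j)} &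
        \sum_(i in S) f i (om i) <= \sum_(i in S) \sum_s p s * f i s].
  move=> om_gt0 ps om_r rs le; exists (dfwith om s).
  have memS' i : i \in S -> x != i -> i \in S' by rewrite !inE eq_sym => -> ->.
  split=> [i iS|i j iS jS eij|].
  - have [<-|xi] := eqVneq x i; first by rewrite dfwith_in.
    by rewrite dfwith_out// om_gt0// memS'.
  - have [xi|xi] := eqVneq x i; have [xj|xj] := eqVneq x j.
    + by move: eij; rewrite -xi -xj eirr.
    + by subst i; rewrite dfwith_in dfwith_out//; apply: rs; rewrite ?memS'.
    + subst j; rewrite dfwith_in dfwith_out//; apply: rsym; apply: rs.
        exact: memS'.
      by rewrite esym.
    + by rewrite !dfwith_out//; apply: om_r; rewrite ?memS'.
  - rewrite sumD1 dfwith_in (eq_bigr (fun i => f i (om i)))// => i.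
    by rewrite !inE eq_sym => /andP[xi _]; rewrite dfwith_out.
have [/existsP[y /andP[yS exy]]|noy] := boolP [exists y, (y \in S) && e x y].
- have [w [w0 wx wy wr]] := rcoupling exy.
  pose h t := (\sum_s w s t * f x s) / p t.
  pose f' := dfwith f (fun t => f y t + h t).
  have [om [om_gt0 om_r om_le]] := IHN S' f' ltS'N acyc'.
  have yS' : y \in S' by rewrite !inE yS andbT; apply: contraTneq exy => ->; rewrite eirr.
  have py := om_gt0 y yS'.
  (* The state of [x] is taken from the column of [w] at [om y], whose mass is positive: it is
     compatible with [om y] and costs at most the conditional mean [h (om y)]. *)
  have [|s [ws fs]] := @exists_le_mean _ _ (w ^~ (om y)) (f x) (fun s => w0 s _).
    by rewrite wy.
  apply: (insert om s) => // [|j jS' exj|].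
  + rewrite -wx (bigD1 (om y))//= ltr_pwDl// sumr_ge0// => *; exact: w0.
  + have -> : j = y by apply: leaf => //; case/setD1P: jS'.
    exact: wr.
  + have split_y (F F' : V -> R) (d : R) : F' y = F y + d ->
        (forall i, i != y -> F' i = F i) ->
        \sum_(i in S') F' i = d + \sum_(i in S') F i.
      move=> Fy Fi; rewrite (bigD1 y)//= Fy [in RHS](bigD1 y)//= addrCA addrA.
      by congr (_ + _); apply: eq_bigr => i /andP[_ /Fi].
    (* Law of total expectation: moving the cost of [x] to [y] preserves the expected total. At a
       state of [y] of mass zero the whole column of [w] vanishes. *)
    rewrite [leRHS]sumD1; have h_mean : \sum_t p t * h t = \sum_s p s * f x s.
      transitivity (\sum_t \sum_s w s t * f x s).
        apply: eq_bigr => t _; rewrite /h mulrC.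
        have [pt|pt] := eqVneq (p t) 0; last by rewrite divfK.
        rewrite pt mulr0 big1// => s' _; rewrite -wy in pt.
        by rewrite (psumr_eq0P _ pt) ?mul0r.
      by rewrite exchange_big; apply: eq_bigr => s' _; rewrite -mulr_suml wx.
    move: om_le.
    rewrite (split_y (fun i => f i (om i)) (fun i => f' i (om i)) (h (om y))).
    * rewrite (split_y (fun i => \sum_s p s * f i s) (fun i => \sum_s p s * f' i s)
                       (\sum_s p s * f x s)).
      - move=> le; apply: le_trans le; rewrite lerD2r /h ler_pdivlMr//.
        by move: fs; rewrite wy.
      - rewrite /f' dfwith_in -h_mean -big_split; apply: eq_bigr => t _ /=.
        by rewrite mulrDr.
      - by move=> i iy; rewrite /f' dfwith_out// eq_sym.
    * by rewrite /f' dfwith_in.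
    * by move=> i iy; rewrite /f' dfwith_out// eq_sym.
- have [|s [ps fs]] := @exists_le_mean _ _ (@p x) (f x) (@p_ge0 x).
    by rewrite p_sum.
  have [om [om_gt0 om_r om_le]] := IHN S' f ltS'N acyc'.
  apply: (insert om s) => // [j /setD1P[_ jS] exj|].
    by move: noy; rewrite negb_exists => /forallP/(_ j); rewrite jS exj.
  by rewrite sumD1 lerD//; move: fs; rewrite p_sum mulr1.
Qed.
End Gluing.

(** * Moments determine the law of a 0/1 vector *)

Section Moments.
Variables (R : realFieldType) (U : finType).

Definition zero_one (S : {set U}) (x : U -> R) : Prop :=
  {in S, forall v, x v = 0 \/ x v = 1}.

(** Encodes the restriction of a 0/1 vector to [S] by its support, a label from a finite type. *)
Definition ones (S : {set U}) (x : U -> R) : {set U} :=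
  [set v in S | x v == 1]%SET.

Lemma ones_inj S x x' : zero_one S x -> zero_one S x' ->
  ones S x = ones S x' -> {in S, x =1 x'}.
Proof.
move=> xS xS' /setP eq_ones v vS; move: (eq_ones v); rewrite !inE vS /=.
by case: (xS v vS) (xS' v vS) => -> [] ->; rewrite ?eqxx // eq_sym oner_eq0.
Qed.

(** Turns the event of having support [c] into a polynomial, whose expectation is a combination of
    moments. *)
Lemma ones_indicator S (c : {set U}) x : zero_one S x -> c \subset S ->
  (if ones S x == c then 1 else 0)
  = \prod_(v in c) x v * \prod_(v in S :\: c) (1 - x v).
Proof.
move=> xS /fintype.subsetP cS; case: eqP => [<-|ne].
  rewrite big1 ?mul1r => [|v]; last by rewrite inE => /andP[_ /eqP].
  rewrite big1 // => v; rewrite !inE => /andP[+ vS]; rewrite vS /=.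
  by case: (xS v vS) => ->; rewrite ?subr0 ?eqxx.
apply/esym/eqP/negPn/negP; rewrite mulf_eq0 negb_or => /andP[].
move=> /prodf_neq0 xc /prodf_neq0 xSc; case: ne; apply/setP => v; rewrite inE.
have [vc|vNc] := boolP (v \in c).
  have vS := cS v vc; rewrite vS /=.
  by case: (xS v vS) (xc v vc) => ->; rewrite ?eqxx.
have [vS|//] := boolP (v \in S).
have := xSc v; rewrite inE vNc vS => /(_ isT).
by case: (xS v vS) => ->; rewrite ?subrr ?eqxx // => _; rewrite eq_sym oner_eq0.
Qed.

(** Inclusion-exclusion: by induction on [C], each factor [1 - x u] splits a mixed moment into two
    with fewer such factors, down to the pure moments. *)
Lemma moments_determine (A B : finType) (p : A -> R) (q : B -> R)
    (x : A -> U -> R) (y : B -> U -> R) (S : {set U}) :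
  (forall s, zero_one S (x s)) -> (forall t, zero_one S (y t)) ->
  (forall D : {set U}, D \subset S ->
    \sum_s p s * \prod_(v in D) x s v = \sum_t q t * \prod_(v in D) y t v) ->
  forall c, \sum_(s | ones S (x s) == c) p s = \sum_(t | ones S (y t) == c) q t.
Proof.
move=> x01 y01 moments c.
have [cS|cNS] := boolP (c \subset S); last first.
  rewrite !big1 // => s /eqP sc; exfalso; move/negP: cNS; apply.
    by rewrite -sc; apply/fintype.subsetP => v; rewrite inE => /andP[].
  by rewrite -sc; apply/fintype.subsetP => v; rewrite inE => /andP[].
have mixed (C D : {set U}) : C \subset S -> D \subset S -> [disjoint D & C] ->
    \sum_s p s * (\prod_(v in D) x s v * \prod_(v in C) (1 - x s v))
    = \sum_t q t * (\prod_(v in D) y t v * \prod_(v in C) (1 - y t v)).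
  have [N] := ubnP #|C|; elim: N => // N IHN in C D *; rewrite ltnS => leCN CS DS dis.
  have [->|/set0Pn[u uC]] := eqVneq C finset.set0.
    by under eq_bigr do rewrite big_set0 mulr1;
      under [RHS]eq_bigr do rewrite big_set0 mulr1; apply: moments.
  have uND : u \notin D by apply: contraTN dis => uD; apply/pred0Pn; exists u; rewrite /= uD.
  have C'N : (#|C :\ u| < N)%N by rewrite (leq_trans _ leCN) // [leqRHS](cardsD1 u) uC.
  have C'S : C :\ u \subset S by apply: fintype.subset_trans CS; apply: subD1set.
  have uDS : u |: D \subset S by rewrite finset.subUset DS finset.sub1set (fintype.subsetP CS).
  have dis1 : [disjoint D & C :\ u] by apply: disjointWr dis; apply: subD1set.
  have dis2 : [disjoint u |: D & C :\ u].
    rewrite disjoint_subset; apply/fintype.subsetP => v.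
    by rewrite !inE => /predU1P[->|/(disjointFr dis)->]; rewrite ?eqxx ?andbF.
  have split_u (f : U -> R) : \prod_(v in D) f v * \prod_(v in C) (1 - f v)
      = \prod_(v in D) f v * \prod_(v in C :\ u) (1 - f v)
        - \prod_(v in u |: D) f v * \prod_(v in C :\ u) (1 - f v).
    by rewrite (big_setD1 u uC) big_setU1 //=; ring.
  under eq_bigr do rewrite split_u mulrBr; under [RHS]eq_bigr do rewrite split_u mulrBr.
  by rewrite !sumrB !IHN.
have ind (f : U -> R) a : zero_one S f -> (if ones S f == c then a else 0)
    = a * (\prod_(v in c) f v * \prod_(v in S :\: c) (1 - f v)).
  by move=> f01; rewrite -ones_indicator //; case: ifP; rewrite ?mulr1 ?mulr0.
rewrite big_mkcond [RHS]big_mkcond /=.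
under eq_bigr => s _ do rewrite (ind _ _ (x01 s)).
under [RHS]eq_bigr => t _ do rewrite (ind _ _ (y01 t)).
apply: mixed => //; first exact: subsetDl.
by rewrite -finset.setI_eq0; apply/eqP/setP => v; rewrite !inE; case: (v \in c).
Qed.

End Moments.

(** * Tree decompositions, k-good sets and merging of copies *)

Section Rounding.
Variables (R : realType) (n m : nat) (P : mip n m) (T : reformulation R P).

Local Notation V := (node T).

Lemma adj_tree : is_tree (adj T).
Proof. by case: (bag_decomposition T). Qed.

(** The nodes whose bags contain [v] are connected, so equality along edges propagates along a path
    of such nodes. *)
Lemma constant_on_copies (X : Type) (phi : V -> X) v :
  (forall i j, adj T i j -> v \in bag T i -> v \in bag T j -> phi i = phi j) ->
  forall i j, v \in bag T i -> v \in bag T j -> phi i = phi j.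
Proof.
move=> phi_adj i j vi vj; have [_ /(_ v)[_ conn _] _ _] := bag_decomposition T.
have := conn i j; rewrite !inE => /(_ vi vj) /connectP[p pth ->].
elim: p i {vi} pth => //= a p IH i /andP[+ /IH <-].
by rewrite /induced /= !inE => /and3P[vi va ia]; apply: phi_adj.
Qed.

(** If the intersection is nonempty, both ends of the edge meet [W] and lie in one component, where
    the bound holds by definition. *)
Lemma k_good_edge k W i j : k_good T k W -> adj T i j ->
  (#|bag T i :&: bag T j :&: W| <= k)%N.
Proof.
move=> good ij; have [->|/set0Pn[v]] := eqVneq (bag T i :&: bag T j :&: W) finset.set0.
  by rewrite cards0.
rewrite !inE -andbA => /and3P[vi vj vW].
have iM : i \in meeting T W.
  by rewrite inE; apply/set0Pn; exists v; rewrite inE vi.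
have jM : j \in meeting T W.
  by rewrite inE; apply/set0Pn; exists v; rewrite inE vj.
pose C := [set l in meeting T W | connect (induced (adj T) (meeting T W)) i l]%SET.
have CT : C \in components (adj T) (meeting T W) by apply: imset_f.
have iC : i \in C by rewrite inE iM connect0.
have jC : j \in C by rewrite inE jM; apply: connect1; apply/and3P.
move/forallP: good => /(_ C); rewrite CT => /forallP/(_ i).
by rewrite iC => /forallP/(_ j); rewrite jC ij.
Qed.

Lemma small_k_good k (W : {set 'I_n}) : (#|W| <= k)%N -> k_good T k W.
Proof.
move=> Wk; apply/forallP => C; apply/implyP => _; apply/forallP => i.
apply/implyP => _; apply/forallP => j; apply/implyP => _; apply/implyP => _.
by apply: leq_trans Wk; apply/subset_leq_card/finset.subsetIr.
Qed.

Lemma exchange_bags (F : V -> 'I_n -> R) :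
  \sum_i \sum_(v in bag T i) F i v = \sum_v \sum_(i | v \in bag T i) F i v.
Proof. by rewrite (exchange_big_dep predT). Qed.

Lemma blockX_ge0 i (x : xspace R n) v : blockX i x -> v \in bag T i -> 0 <= x v 0.
Proof. by move=> [_ /(_ v)] + vi => /(_ vi); case: ifP => // _ [] ->. Qed.

(** Raising entries keeps the constraints because [lhs] is non-positive, and a maximum of 0/1 values
    is 0/1. For [v] in [W] all copies coincide; otherwise the maximum is at most the sum of the
    copies, so each copy is charged the total cost of [v]. *)
Lemma merge_copies (W : {set 'I_n}) (X : V -> xspace R n) :
  covering T -> (forall i, blockX i (X i)) ->
  (forall i j v, adj T i j -> v \in bag T i :&: bag T j :&: W ->
     X i v 0 = X j v 0) ->
  exists z : xspace R n, (forall i : V, blockX i z) /\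
    objective (T := T) (fun _ => z) <=
      \sum_i \sum_(v in bag T i)
        (if v \in W then bcost T i v
         else \sum_(j | v \in bag T j) bcost T j v) * X i v 0.
Proof.
move=> [bcost0 lhs0 _] XX agree.
(* The default 0 of the maximum is harmless, since all copies are non-negative. *)
pose z : xspace R n := \col_v \big[Num.max/0]_(i | v \in bag T i) X i v 0.
have X0 i v : v \in bag T i -> 0 <= X i v 0 by apply: blockX_ge0.
have le_z i v : v \in bag T i -> X i v 0 <= z v 0.
  by move=> vi; rewrite mxE; apply: (le_bigmax_cond _ (fun i => X i v 0)).
exists z; split=> [i|].
  split=> [r ri|v vi].
    have [/(_ r ri) + _] := XX i; apply: le_trans; apply: ler_sum => v vi.
    by apply: ler_wnM2l; [rewrite -[0](rmorph0 (@ratr R)) ler_rat|apply: le_z].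
  case: ifP => vb; last by apply: le_trans (X0 i v vi) (le_z i v vi).
  rewrite mxE; apply: (big_ind (fun u => u = 0 \/ u = 1)) => [|a b a01 b01|j vj]; first by left.
    by rewrite /Order.max; case: ifP.
  by have [_ /(_ v vj)] := XX j; rewrite vb.
rewrite /objective !exchange_bags; apply: ler_sum => v _.
have [vW|vNW] := boolP (v \in W).
  apply: ler_sum => i vi; apply: ler_wpM2l; first exact: bcost0.
  rewrite mxE; apply: bigmax_le => [|j vj]; first exact: X0 vi.
  rewrite le_eqVlt; apply/orP; left; apply/eqP.
  move: vj vi; apply: (@constant_on_copies _ (fun i => X i v 0) v) => a b ab va vb.
  by apply: agree => //; rewrite !inE va vb.
rewrite -mulr_suml -mulr_sumr; apply: ler_wpM2l; first exact: sumr_ge0 (bcost0 ^~ v).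
rewrite mxE; apply: bigmax_le => [|i vi]; first by apply: sumr_ge0 => i; apply: X0.
by rewrite (bigD1 i vi) lerDl; apply: sumr_ge0 => j /andP[+ _]; apply: X0.
Qed.

(** * Rounding of dual-feasible points *)

Definition opt_feasible (x : V -> xspace R n) : Prop :=
  (forall i, blockX i (x i)) /\
  (forall i j v, adj T i j -> v \in bag T i :&: bag T j -> x i v 0 = x j v 0).

Definition dual_feasible k (y : V -> (xspace R n * wspace R n)%type) : Prop :=
  (forall i, conv (blockXM i) (y i)) /\
  (forall i j (S : {set 'I_n}), adj T i j ->
     S \subset bag T i :&: bag T j -> (#|S| <= k)%N -> (y i).2 S = (y j).2 S).

(* The part of the dual objective due to [v]: D_v in the header. *)
Definition mass (y : V -> (xspace R n * wspace R n)%type) (v : 'I_n) : R :=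
  \sum_(i | v \in bag T i) bcost T i v * (y i).1 v 0.

(** Convex weights are read as a probability law on block points, under which [y.1] is the mean and
    [y.2] lists the moments. *)
Lemma conv_expectation i y : conv (blockXM i) y ->
  exists (N : nat) (l : 'I_N -> R) (x : 'I_N -> xspace R n),
    [/\ forall s, 0 <= l s, \sum_s l s = 1, forall s, blockX i (x s),
        forall v, y.1 v 0 = \sum_s l s * x s v 0 &
        forall S : {set 'I_n}, S \subset bag T i ->
          y.2 S = \sum_s l s * \prod_(v in S) x s v 0].
Proof.
move=> [N [l [p [l0 l1 pX ->]]]]; exists N, l, (fun s => (p s).1).
split=> // [s|v|S Si]; first by case: (pX s).
  by rewrite raddf_sum summxE; apply: eq_bigr => s _; rewrite mxE.
rewrite raddf_sum sum_ffunE; apply: eq_bigr => s _.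
by rewrite ffunE; case: (pX s) => _ /(_ S Si) ->.
Qed.

Section Dual.
Variables (k : nat) (y : V -> (xspace R n * wspace R n)%type).
Hypotheses (hbin : shared_binary T) (hcov : covering T) (hk : (1 <= k)%N).
Hypothesis feas : dual_feasible k y.

(** Since [1 <= k], singletons are among the dualized sets, and the moment of a singleton is the
    mean of its variable. *)
Lemma dual_copies_eq v i j : v \in bag T i -> v \in bag T j ->
  (y i).1 v 0 = (y j).1 v 0.
Proof.
move=> vi vj; apply: (constant_on_copies (phi := fun i => (y i).1 v 0) _ vi vj) => {vi vj}i {}j ij vi vj.
have moment1 a : v \in bag T a -> (y a).1 v 0 = (y a).2 [set v]%SET.
  move=> va; have [N [l [x [_ _ _ -> ->]]]] := conv_expectation (feas.1 a).
    by apply: eq_bigr => s _; rewrite big_set1.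
  by rewrite finset.sub1set.
by rewrite !moment1 // (feas.2 i j) ?cards1 // finset.sub1set inE vi.
Qed.

Lemma dual_ge0 v i : v \in bag T i -> 0 <= (y i).1 v 0.
Proof.
move=> vi; have [N [l [x [l0 _ xX -> _]]]] := conv_expectation (feas.1 i).
by apply: sumr_ge0 => s _; rewrite mulr_ge0 // (blockX_ge0 (xX s)).
Qed.

Lemma mass_ge0 v : 0 <= mass y v.
Proof.
case: hcov => bcost0 _ _; apply: sumr_ge0 => i vi.
by rewrite mulr_ge0 ?bcost0 ?dual_ge0.
Qed.

Lemma objective_mass : objective (T := T) (fun i => (y i).1) = \sum_v mass y v.
Proof. exact: exchange_bags. Qed.

(** Equality on the shared variables of [W] is the relation to be glued: equal moments give the
    couplings, [glue_forest] selects block points costing at most the mean, and [merge_copies] turns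
    them into one common point. *)
Lemma round_k_good W : k_good T k W ->
  exists x, opt_feasible x /\
    objective (T := T) x <= \sum_v (if v \in W then 1 else (tau T)%:R) * mass y v.
Proof.
move=> good.
have tens i := conv_expectation (feas.1 i).
pose N i := projT1 (cid (tens i)); have exl i := projT2 (cid (tens i)).
pose l i : 'I_(N i) -> R := projT1 (cid (exl i)); have exx i := projT2 (cid (exl i)).
pose x i : 'I_(N i) -> xspace R n := projT1 (cid (exx i)); have xP i := projT2 (cid (exx i)).
have {}xP i : [/\ forall s, 0 <= l i s, \sum_s l i s = 1,
    forall s, blockX i (x i s),
    forall v, (y i).1 v 0 = \sum_s l i s * x i s v 0 &
    forall S : {set 'I_n}, S \subset bag T i ->
      (y i).2 S = \sum_s l i s * \prod_(v in S) x i s v 0].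
  exact: xP.
pose agree i j (s : 'I_(N i)) (t : 'I_(N j)) :=
  forall v, v \in bag T i :&: bag T j :&: W -> x i s v 0 = x j t v 0.
have [adj_sym adj_irr [_ _ acyc]] := adj_tree.
have coupled i j : adj T i j -> exists w, coupling (l i) (l j) (@agree i j) w.
  move=> ij; set S := bag T i :&: bag T j :&: W.
  have Sij : S \subset bag T i :&: bag T j by apply: finset.subsetIl.
  have [li li1 xi yi1 yi2] := xP i; have [lj lj1 xj yj1 yj2] := xP j.
  have Sbin v : v \in S -> [/\ v \in binary P, v \in bag T i & v \in bag T j].
    move=> /(fintype.subsetP Sij) vS; rewrite (hbin ij vS).
    by move: vS; rewrite inE => /andP[].
  have xi01 s : zero_one S (fun v => x i s v 0).
    by move=> v /Sbin[vb vi _]; have [_ /(_ v vi)] := xi s; rewrite vb.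
  have xj01 t : zero_one S (fun v => x j t v 0).
    by move=> v /Sbin[vb _ vj]; have [_ /(_ v vj)] := xj t; rewrite vb.
  have moments (D : {set 'I_n}) : D \subset S ->
      \sum_s l i s * \prod_(v in D) x i s v 0
      = \sum_t l j t * \prod_(v in D) x j t v 0.
    move=> DS; have Dij := fintype.subset_trans DS Sij.
    have := Dij; rewrite finset.subsetI => /andP[Di Dj].
    rewrite -yi2 // -yj2 //; apply: feas.2 => //.
    exact: leq_trans (subset_leq_card DS) (k_good_edge good ij).
  have [w [w0 wi wj wr]] := coupling_pushforward li lj
    (moments_determine xi01 xj01 moments).
  by exists w; split=> // s t /wr; apply: ones_inj.
have agree_sym i j (s : 'I_(N i)) (t : 'I_(N j)) : agree i j s t -> agree j i t s.
  by move=> st v; rewrite (finset.setIC (bag T j)) => /st.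
(* These are the coefficients in the bound of [merge_copies], so gluing controls the cost after
   merging. *)
pose c i v := if v \in W then bcost T i v else \sum_(j | v \in bag T j) bcost T j v.
have [||om [_ om_agree om_le]] := glue_forest adj_sym adj_irr _ _ agree_sym coupled
  (fun i s => \sum_(v in bag T i) c i v * x i s v 0) acyc.
- by move=> i s; have [] := xP i.
- by move=> i; have [] := xP i.
have [||z [zX z_le]] := merge_copies (W := W) (X := fun i => x i (om i)) hcov.
- by move=> i; have [] := xP i.
- by move=> i j v ij; apply: om_agree; rewrite ?inE.
exists (fun _ => z); split; first by split.
have setTE (F : V -> R) : \sum_(i in [set: V]%SET) F i = \sum_i F i.
  by apply: eq_bigl => i; rewrite inE.
apply: le_trans z_le _; move: om_le; rewrite !setTE => /le_trans; apply.
rewrite (eq_bigr (fun i => \sum_(v in bag T i) c i v * (y i).1 v 0)); last first.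
  move=> i _; under eq_bigr do rewrite mulr_sumr.
  rewrite exchange_big; apply: eq_bigr => v _; have [_ _ _ -> _] := xP i.
  by rewrite mulr_sumr; apply: eq_bigr => s _; rewrite mulrCA.
rewrite exchange_bags; apply: ler_sum => v _; rewrite /c.
case: ifP => _; first by rewrite mul1r.
(* The dual values of the copies of [v] are equal, so the total cost of [v] at any one copy is
   [mass y v]; at most [tau T] copies are summed. *)
apply: (@le_trans _ _ (\sum_(i | v \in bag T i) mass y v)).
  apply: ler_sum => i vi; rewrite /mass mulr_suml; apply: ler_sum => j vj.
  by rewrite (dual_copies_eq vi vj).
rewrite sumr_const -[_ *+ _]mulr_natl; apply: ler_wpM2r; first exact: mass_ge0.
rewrite ler_nat; apply: leq_trans (leq_bigmax v); rewrite cardsE.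
exact: leqnn.
Qed.

(** The rounding bounds are summed with weights [alpha W]. The covering condition and non-negative
    masses bound D by the weighted sum of the parts on [W]; this is used with the factor [tau - 1],
    hence the need for [1 <= tau]. *)
Lemma dual_round_average (alpha : {set 'I_n} -> R) (o : R) :
  (forall W, k_good T k W -> 0 <= alpha W) ->
  (forall v, 1 <= \sum_(W | k_good T k W) alpha W * (v \in W)%:R) ->
  (1 <= tau T)%N ->
  (forall x, opt_feasible x -> o <= objective (T := T) x) ->
  (\sum_(W | k_good T k W) alpha W) * o <=
  (1 - (tau T)%:R + (tau T)%:R * \sum_(W | k_good T k W) alpha W)
    * objective (T := T) (fun i => (y i).1).
Proof.
move=> a0 a1 tau1 o_le; rewrite objective_mass; set D := \sum_v mass y v.
(* The coefficient of [mass y v], 1 on [W] and tau off it, equals tau minus [tau - 1] times the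
   indicator of [W]. *)
have le W : k_good T k W ->
    o <= (tau T)%:R * D - ((tau T)%:R - 1) * \sum_v (v \in W)%:R * mass y v.
  move=> good; have [x [xf x_le]] := round_k_good good.
  apply: le_trans (o_le x xf) (le_trans x_le _).
  rewrite /D !mulr_sumr -sumrB ler_sum // => v _.
  by case: (v \in W); rewrite /= ?mulr1n ?mulr0n le_eqVlt; apply/orP; left; apply/eqP; ring.
have D_le : D <= \sum_(W | k_good T k W) alpha W * \sum_v (v \in W)%:R * mass y v.
  under eq_bigr do rewrite mulr_sumr.
  rewrite exchange_big /D ler_sum // => v _.
  under eq_bigr do rewrite mulrA.
  by rewrite -mulr_suml ler_peMl // mass_ge0.
have : (\sum_(W | k_good T k W) alpha W) * o <= \sum_(W | k_good T k W)
    alpha W * ((tau T)%:R * D - ((tau T)%:R - 1) * \sum_v (v \in W)%:R * mass y v).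
  by rewrite mulr_suml ler_sum // => W good; rewrite ler_wpM2l ?a0 ?le.
move=> /le_trans; apply.
under eq_bigr do rewrite mulrBr [alpha _ * ((_ - 1) * _)]mulrCA.
rewrite sumrB -mulr_sumr -!mulr_suml.
have tau_ge0 : 0 <= (tau T)%:R - 1 :> R by rewrite subr_ge0 ler1n.
by have := ler_wpM2l tau_ge0 D_le; lra.
Qed.
End Dual.
End Rounding.

(** * Passage to the infimum over covers, and the theorem *)

(** [theta] is only an infimum of cover weights. Both sides are affine in [s], so a strict violation
    at [t] would persist just to the right of [t]. *)
Lemma affine_le_inf (R : realFieldType) (t o c D : R) :
  (forall u, t < u ->
    exists s, [/\ t <= s, s < u & s * o <= (1 - c + c * s) * D]) ->
  t * o <= (1 - c + c * t) * D.
Proof.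
move=> near; rewrite leNgt; apply/negP => lt_t.
(* If [c * D <= o], the violation does not shrink as [s] grows, and any [u > t] will do. *)
have [slope|slope] := lerP (c * D) o.
  have [|s [ts _ le_s]] := near (t + 1); first by rewrite ltrDl.
  by nra.
(* Otherwise [u] is the point where the two affine sides meet; the violation holds everywhere to its
   left. *)
have [|s [_ su le_s]] := near (D * (c - 1) / (c * D - o)).
  by rewrite ltr_pdivlMr ?subr_gt0 //; lra.
by move: su; rewrite ltr_pdivlMr ?subr_gt0 //; lra.
Qed.

Local Open Scope ereal_scope.

Theorem theorem10 (R : realType) (n m : nat) (P : mip n m)
    (T : reformulation R P) (k : nat)
    (hbin : shared_binary T) (hcov : covering T) (hk : (1 <= k <= n)%N) :
  theta T k / (1 - (tau T)%:R%:E + (tau T)%:R%:E * theta T k) * OPT T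
    <= DUAL_M T k /\
  DUAL_M T k <= OPT T.
Proof.
have /andP[k1 kn] := hk; have v0 : 'I_n := Ordinal (leq_trans k1 kn).
split; last first.
  (* A feasible point of OPT, completed by its monomials and taken as a one-point convex
     combination, is dual feasible. *)
  apply: le_ereal_inf_tmp => _ [x [xX agree] <-]; apply: ereal_inf_lbound.
  exists (fun i => (x i, [ffun S : {set 'I_n} => \prod_(v in S) x i v 0]%R)) => //.
  split=> [i|i j S ij Sij _] /=.
    exists 1%N, (fun=> 1%R), (fun=> (x i, [ffun S : {set 'I_n} => \prod_(v in S) x i v 0]%R)).
    split=> //; rewrite ?big_ord1 ?scale1r //.
    by move=> _; split=> [|S _]; [exact: xX|rewrite ffunE].
  rewrite !ffunE; apply: eq_bigr => v vS; apply: agree ij _.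
  exact: (fintype.subsetP Sij).
have tau1 : (1 <= tau T)%N.
  have [_ _ _ /(_ v0)[i vi]] := bag_decomposition T.
  apply: leq_trans (leq_bigmax v0); rewrite card_gt0.
  by apply/set0Pn; exists i; rewrite inE.
(* Covering the single variable [v0] already takes total weight 1. *)
have theta_ge1 : 1 <= theta T k.
  apply: le_ereal_inf_tmp => _ [a [a0 /(_ v0) a1] <-]; rewrite lee_fin.
  apply: le_trans a1 _; apply: ler_sum => W good.
  by rewrite ler_piMr ?a0 // lern1 leq_b1.
(* Weight 1 on every k-good set is a cover, because singletons are k-good. *)
have theta_lty : theta T k < +oo.
  have : theta T k <= (\sum_(W | k_good T k W) (1 : R))%R%:E.
    apply: ereal_inf_lbound; exists (fun=> 1%R) => //; split=> // v.
    rewrite (bigD1 [set v]%SET) /=; last by apply: small_k_good; rewrite cards1.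
    by rewrite inE eqxx mulr1 lerDl sumr_ge0 // => W _; rewrite mul1r ler0n.
  by move=> /le_lt_trans; apply; rewrite ltry.
case theta_t : (theta T k) theta_ge1 theta_lty => [t| |] // t1 _.
rewrite lee_fin in t1; set d := (1 - (tau T)%:R + (tau T)%:R * t)%R.
(* As [d] is [1 + tau * (t - 1)] with [t >= 1], the quotient is an ordinary real one. *)
have d_gt0 : (0 < d)%R.
  have : (0 <= ((tau T)%:R : R) - 1)%R by rewrite subr_ge0 ler1n.
  by rewrite /d; nra.
rewrite -EFinM -EFinB -EFinD -/d inver gt_eqF // -EFinM.
apply: le_ereal_inf_tmp => _ [y feas <-].
(* Rounding the given dual point with the empty set yields a feasible point of OPT; with
   non-negative costs, OPT is therefore a real number [o]. *)
have good0 : k_good T k finset.set0 by apply: small_k_good; rewrite cards0.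
have [x0 [x0f _]] := round_k_good hbin hcov k1 feas good0.
have opt_ge0 : 0 <= OPT T.
  case: hcov => c0 _ _.
  apply: le_ereal_inf_tmp => _ [x [xX _] <-]; rewrite lee_fin.
  by apply: sumr_ge0 => i _; apply: sumr_ge0 => v vi; rewrite mulr_ge0 ?c0 ?(blockX_ge0 (xX i)).
have opt_le (x : node T -> xspace R n) : opt_feasible x -> OPT T <= (objective x)%:E.
  by move=> xf; apply: ereal_inf_lbound; exists x.
have := opt_le x0 x0f; case opt_o : (OPT T) opt_ge0 => [o| |] // _ _.
rewrite -EFinM lee_fin mulrAC ler_pdivrMr //.
set D := objective _.
have o_le (x : node T -> xspace R n) : opt_feasible x -> (o <= objective x)%R.
  by move=> /opt_le; rewrite opt_o lee_fin.
(* Covers of weight below [u] exist for each [u > t], and each of them gives the averaged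
   inequality. *)
rewrite [leRHS]mulrC; apply: affine_le_inf => u.
rewrite -lte_fin -theta_t => /ereal_inf_lt[_ [a [a0 a1] <-]]; rewrite lte_fin => su.
eexists; split; [|exact: su|exact: dual_round_average].
by rewrite -lee_fin -theta_t; apply: ereal_inf_lbound; exists a.
Qed.
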